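(* Let $\theta\in(0,\pi)$ and $\alpha>0$. (i) If $0<\beta<\frac{\theta}{2}$ and $\tanh(\alpha)=\cot\left(\frac{\theta}{2}\right)\tan(\beta)$, then \[ \int_0^\alpha \frac{x\,dx}{\cosh(2x)+\cos\theta}+\int_0^\beta \frac{y\,dy}{\cos(2y)-\cos\theta}=\frac{\alpha\beta}{\sin\theta}. \] (ii) If $\frac{\pi-\theta}{2}<\beta<\frac{\pi}{2}$ and $\tanh(\alpha)\tan(\beta)=\cot\left(\frac{\theta}{2}\right)$, then \[ \int_0^\alpha \frac{x\,dx}{\cosh(2x)+\cos\theta}+\int_\beta^{\pi/2} \frac{y\,dy}{\cos(2y)+\cos\theta}=-\frac{\alpha\beta}{\sin\theta}. \] *)

(* Defs.v *)
From Stdlib Require Import Reals.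
From Coquelicot Require Import Coquelicot.
Open Scope R_scope.

Definition cot (x : R) : R := cos x / sin x.

(* Main.v *)
Require Import Defs.
From Stdlib Require Import Reals Lra.
From Coquelicot Require Import Coquelicot.
Open Scope R_scope.

(** Both identities are integration by parts for [x * b x], where [b] is the
    curve that the constraint between [alpha] and [beta] traces out.

    Put [B x = atan (tan (theta / 2) * tanh x)] ([gd_angle] below).  Solving
    the constraint for [beta] gives [beta = B alpha] in part (i) and
    [beta = PI / 2 - B alpha] in part (ii).  Two facts about [B] carry the
    proof:
    - [B' x = sin theta / (cosh (2 x) + cos theta)] ([is_derive_gd_angle]), so
      the first integrand is [x * B' x / sin theta];
    - [cos (2 B x) - cos theta = (sin theta)^2 / (cosh (2 x) + cos theta)]
      ([cos_double_gd_angle]), so substituting [y = B x] turns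
      [y dy / (cos (2 y) - cos theta)] into [B x dx / sin theta].
    Hence the sum of the two integrals is the integral over [0, alpha] of
    [(x * B x)' / sin theta].  In part (ii) the substitution is
    [y = PI / 2 - B x], which exchanges [cos (2 y)] with [- cos (2 B x)] and
    starts at [PI / 2] for [x = 0]; the same computation applies with the
    opposite sign.  [RInt_add_RInt_along] treats both cases at once. *)

(** * Integration by parts along a curve *)

(** Integration by parts in the shape of the equality case of Young's
    inequality: the integral of [c * x * b' x] and, after substituting
    [y = b x], the integral of [c * b x] add up to that of [(c * x * b x)']. *)
Lemma RInt_add_RInt_along (f g b db : R -> R) (c a : R)
    (hb : forall x, Rmin 0 a <= x <= Rmax 0 a -> is_derive b x (db x))
    (hdb : forall x, Rmin 0 a <= x <= Rmax 0 a -> continuous db x)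
    (hg : forall x, Rmin 0 a <= x <= Rmax 0 a -> continuous g (b x))
    (hf : forall x, Rmin 0 a <= x <= Rmax 0 a -> f x = c * (x * db x))
    (hgb : forall x, Rmin 0 a <= x <= Rmax 0 a -> db x * g (b x) = c * b x) :
  RInt f 0 a + RInt g (b 0) (b a) = c * (a * b a).
Proof.
  assert (cb : forall x, Rmin 0 a <= x <= Rmax 0 a -> continuous b x).
  { intros x hx. apply (ex_derive_continuous b). exists (db x); auto. }
  rewrite <- (RInt_comp g b db 0 a hg) by auto.
  rewrite (RInt_ext f (fun x => c * (x * db x))) by (intros x hx; apply hf; lra).
  rewrite (RInt_ext (fun x => scal (db x) (g (b x))) (fun x => c * b x))
    by (intros x hx; apply hgb; lra).
  assert (cl : forall x, Rmin 0 a <= x <= Rmax 0 a ->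
                 continuous (fun x => c * (x * db x)) x).
  { intros x hx. apply (continuous_mult (fun _ => c) (fun x => x * db x)).
    - apply continuous_const.
    - apply (continuous_mult (fun x => x) db); [apply continuous_id | auto]. }
  assert (cr : forall x, Rmin 0 a <= x <= Rmax 0 a ->
                 continuous (fun x => c * b x) x).
  { intros x hx. apply (continuous_mult (fun _ => c) b); auto.
    apply continuous_const. }
  etransitivity.
  { symmetry.
    apply (RInt_plus (fun x => c * (x * db x)) (fun x => c * b x));
      apply (ex_RInt_continuous (V := R_CompleteNormedModule)); auto. }
  replace (c * (a * b a))
    with (minus ((fun x => c * (x * b x)) a) ((fun x => c * (x * b x)) 0))
    by (unfold minus, plus, opp; simpl; ring).
  apply is_RInt_unique.
  apply (is_RInt_derive (fun x => c * (x * b x))).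
  - intros x hx. unfold plus; simpl.
    replace (c * (x * db x) + c * b x) with (c * (1 * b x + x * db x)) by ring.
    apply is_derive_scal.
    apply (is_derive_mult (fun x => x) b x 1 (db x));
      [apply (is_derive_id (K := R_AbsRing)) | auto | intros; apply Rmult_comm].
  - intros x hx. apply (continuous_plus (fun x => c * (x * db x))); auto.
Qed.

(** * Hyperbolic and trigonometric identities *)

Lemma cosh_sqr_sub_sinh_sqr (x : R) : cosh x * cosh x - sinh x * sinh x = 1.
Proof.
  assert (h : exp x * exp (- x) = 1)
    by (rewrite <- exp_plus, Rplus_opp_r; apply exp_0).
  unfold cosh, sinh. nra.
Qed.

Lemma cosh_double (x : R) : cosh (2 * x) = cosh x * cosh x + sinh x * sinh x.
Proof.
  unfold cosh, sinh.
  replace (- (2 * x)) with (- x + - x) by ring.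
  replace (2 * x) with (x + x) by ring.
  rewrite !exp_plus. field.
Qed.

Lemma cosh_pos (x : R) : 0 < cosh x.
Proof. unfold cosh. pose proof (exp_pos x). pose proof (exp_pos (- x)). lra. Qed.

Lemma cos_double_atan (u : R) : cos (2 * atan u) = (1 - u * u) / (1 + u * u).
Proof.
  assert (hc : 0 < cos (atan u)) by (apply cos_gt_0; pose proof (atan_bound u); lra).
  assert (hs : sin (atan u) = u * cos (atan u)).
  { rewrite <- (tan_atan u) at 2. unfold tan. field. lra. }
  pose proof (sin2_cos2 (atan u)) as h1. unfold Rsqr in h1.
  rewrite hs in h1. rewrite cos_2a, hs.
  apply Rmult_eq_reg_r with (1 + u * u); [| nra].
  transitivity (1 - u * u); [nra | field; nra].
Qed.

(** * The angle [atan (tan (theta / 2) * tanh x)] *)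

(** A one-parameter deformation of the Gudermannian function [gd]: for
    [theta = PI / 2] it is [atan (tanh x) = gd (2 * x) / 2]. *)
Definition gd_angle (theta x : R) : R := atan (tan (theta / 2) * tanh x).

Lemma gd_angle_0 (theta : R) : gd_angle theta 0 = 0.
Proof.
  unfold gd_angle, tanh. rewrite sinh_0.
  unfold Rdiv at 2. rewrite Rmult_0_l, Rmult_0_r. apply atan_0.
Qed.

(** In this form the denominator is visibly positive, and visibly equal to
    [2 * (cos (theta / 2) * cosh x)^2 * (1 + (tan (theta / 2) * tanh x)^2)],
    whose last factor is the one that [atan] produces. *)
Lemma cosh_double_add_cos (theta x : R) :
  cosh (2 * x) + cos theta =
  2 * (cos (theta / 2) * cos (theta / 2) * (cosh x * cosh x)
       + sin (theta / 2) * sin (theta / 2) * (sinh x * sinh x)).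
Proof.
  replace theta with (2 * (theta / 2)) at 1 by field.
  rewrite cos_2a, cosh_double.
  pose proof (sin2_cos2 (theta / 2)) as h. unfold Rsqr in h.
  pose proof (cosh_sqr_sub_sinh_sqr x) as h'.
  replace (cosh x * cosh x) with (1 + sinh x * sinh x) by lra.
  replace (sin (theta / 2) * sin (theta / 2))
    with (1 - cos (theta / 2) * cos (theta / 2)) by lra.
  ring.
Qed.

Lemma sin_half_angle (theta : R) :
  sin theta = 2 * sin (theta / 2) * cos (theta / 2).
Proof. rewrite <- sin_2a. f_equal. field. Qed.

Lemma cos_half_pos (theta : R) (htheta : 0 < theta < PI) :
  0 < cos (theta / 2).
Proof. apply cos_gt_0; lra. Qed.

Lemma sin_half_pos (theta : R) (htheta : 0 < theta < PI) :
  0 < sin (theta / 2).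
Proof. apply sin_gt_0; lra. Qed.

Lemma cosh_double_add_cos_pos (theta x : R)
    (htheta : 0 < theta < PI) : 0 < cosh (2 * x) + cos theta.
Proof.
  rewrite cosh_double_add_cos.
  pose proof (cos_half_pos theta htheta). pose proof (cosh_pos x).
  assert (0 < cos (theta / 2) * cosh x) by (apply Rmult_lt_0_compat; auto).
  nra.
Qed.

(** This makes the first integrand, up to the factor [sin theta], [x] times the
    derivative of the angle. *)
Lemma is_derive_gd_angle (theta x : R)
    (htheta : 0 < theta < PI) :
  is_derive (gd_angle theta) x (sin theta / (cosh (2 * x) + cos theta)).
Proof.
  pose proof (cos_half_pos theta htheta) as hc. pose proof (cosh_pos x) as hC.
  pose proof (cosh_double_add_cos_pos theta x htheta) as hD.
  assert (ht : is_derive tanh x (1 / (cosh x * cosh x))).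
  { rewrite <- (cosh_sqr_sub_sinh_sqr x).
    replace ((cosh x * cosh x - sinh x * sinh x) / (cosh x * cosh x))
      with ((cosh x * cosh x - sinh x * sinh x) / cosh x ^ 2) by (field; lra).
    apply (is_derive_div sinh cosh); [| | lra];
      apply is_derive_Reals;
      [apply derivable_pt_lim_sinh | apply derivable_pt_lim_cosh]. }
  unfold gd_angle.
  replace (sin theta / (cosh (2 * x) + cos theta))
    with (scal (tan (theta / 2) * (1 / (cosh x * cosh x)))
           (/ (1 + (tan (theta / 2) * tanh x) ^ 2))).
  - apply (is_derive_comp atan (fun x => tan (theta / 2) * tanh x)).
    + apply is_derive_Reals, derivable_pt_lim_atan.
    + apply is_derive_scal, ht.
  - rewrite cosh_double_add_cos in *. rewrite sin_half_angle.
    unfold scal, tan, tanh; simpl; unfold mult; simpl. field.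
    repeat split; nra.
Qed.

(** The denominator of the second integral along the curve, which is what makes
    the substitution work.  The right-hand side being positive also shows that
    this denominator does not vanish along the curve. *)
Lemma cos_double_gd_angle (theta x : R)
    (htheta : 0 < theta < PI) :
  cos (2 * gd_angle theta x) - cos theta
  = sin theta * sin theta / (cosh (2 * x) + cos theta).
Proof.
  pose proof (cos_half_pos theta htheta) as hc. pose proof (cosh_pos x) as hC.
  pose proof (cosh_double_add_cos_pos theta x htheta) as hD.
  unfold gd_angle. rewrite cos_double_atan.
  rewrite cosh_double_add_cos in *.
  rewrite sin_half_angle.
  replace (cos theta) with (cos (2 * (theta / 2))) by (f_equal; field).
  rewrite cos_2a.
  pose proof (sin2_cos2 (theta / 2)) as h. unfold Rsqr in h.
  pose proof (cosh_sqr_sub_sinh_sqr x) as h'.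
  unfold tan, tanh.
  set (c := cos (theta / 2)) in *. set (s := sin (theta / 2)) in *.
  set (C := cosh x) in *. set (S := sinh x) in *.
  transitivity ((c * c * (C * C) - s * s * (S * S))
                / (c * c * (C * C) + s * s * (S * S)) - (c * c - s * s)).
  { field. repeat split; nra. }
  (* Both sides are functions of [S^2] and [c^2] alone. *)
  assert (eC : C * C = 1 + S * S) by lra.
  assert (es : s * s = 1 - c * c) by lra.
  replace (2 * s * c * (2 * s * c)) with (4 * (s * s) * (c * c)) by ring.
  rewrite eC, es in *.
  field. lra.
Qed.

Lemma continuous_gd_angle_derivative (theta x : R)
    (htheta : 0 < theta < PI) :
  continuous (fun x => sin theta / (cosh (2 * x) + cos theta)) x.
Proof.
  apply (ex_derive_continuous
           (fun x => sin theta / (cosh (2 * x) + cos theta))).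
  pose proof (cosh_double_add_cos_pos theta x htheta) as hD.
  unfold cosh in *. auto_derive. lra.
Qed.

Lemma tan_half_mul_cot_half (theta : R) (htheta : 0 < theta < PI) :
  tan (theta / 2) * cot (theta / 2) = 1.
Proof.
  unfold tan, cot. field.
  pose proof (cos_half_pos theta htheta). pose proof (sin_half_pos theta htheta). lra.
Qed.

(** * The two branches *)

(** Inverting the tangent in the constraint requires [beta < PI / 2], which
    follows from [beta < theta / 2]. *)
Lemma RInt_lower_branch (theta alpha beta : R) :
  0 < theta < PI ->
  0 < beta < theta / 2 ->
  tanh alpha = cot (theta / 2) * tan beta ->
  RInt (fun x : R => x / (cosh (2 * x) + cos theta)) 0 alpha
  + RInt (fun y : R => y / (cos (2 * y) - cos theta)) 0 beta
  = alpha * beta / sin theta.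
Proof.
  intros htheta hbeta e.
  assert (eb : beta = gd_angle theta alpha).
  { unfold gd_angle.
    rewrite e, <- Rmult_assoc, (tan_half_mul_cot_half theta htheta), Rmult_1_l.
    symmetry. apply atan_tan. lra. }
  assert (hs : 0 < sin theta) by (apply sin_gt_0; lra).
  rewrite <- (gd_angle_0 theta) at 2. rewrite eb.
  rewrite (RInt_add_RInt_along _ _ (gd_angle theta)
             (fun x => sin theta / (cosh (2 * x) + cos theta)) (/ sin theta)).
  - field. lra.
  - intros x _; apply (is_derive_gd_angle theta x htheta).
  - intros x _; apply (continuous_gd_angle_derivative theta x htheta).
  - intros x _.
    apply (ex_derive_continuous (fun y => y / (cos (2 * y) - cos theta))).
    auto_derive.
    fold (cos (2 * gd_angle theta x) - cos theta).
    rewrite (cos_double_gd_angle theta x htheta).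
    pose proof (cosh_double_add_cos_pos theta x htheta).
    apply Rgt_not_eq, Rdiv_lt_0_compat; nra.
  - intros x _. pose proof (cosh_double_add_cos_pos theta x htheta). field. lra.
  - intros x _. rewrite (cos_double_gd_angle theta x htheta).
    pose proof (cosh_double_add_cos_pos theta x htheta). field. lra.
Qed.

(** With [beta' = PI / 2 - beta] the constraint becomes that of the other branch,
    [tanh alpha = cot (theta / 2) * tan beta'], so the curve is the reflection
    of the previous one. *)
Lemma RInt_upper_branch (theta alpha beta : R) :
  0 < theta < PI ->
  (PI - theta) / 2 < beta < PI / 2 ->
  tanh alpha * tan beta = cot (theta / 2) ->
  RInt (fun x : R => x / (cosh (2 * x) + cos theta)) 0 alpha
  + RInt (fun y : R => y / (cos (2 * y) + cos theta)) beta (PI / 2)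
  = - (alpha * beta / sin theta).
Proof.
  intros htheta hbeta e.
  assert (eb : beta = PI / 2 - gd_angle theta alpha).
  { enough (gd_angle theta alpha = PI / 2 - beta) by lra.
    unfold gd_angle. rewrite <- (atan_tan (PI / 2 - beta)) by lra. f_equal.
    assert (hc : 0 < cos beta) by (apply cos_gt_0; lra).
    assert (hs : 0 < sin beta) by (apply sin_gt_0; lra).
    unfold tan at 2. rewrite sin_shift, cos_shift.
    apply Rmult_eq_reg_r with (tan beta).
    - rewrite Rmult_assoc, e, (tan_half_mul_cot_half theta htheta).
      unfold tan. field. lra.
    - unfold tan. apply Rgt_not_eq, Rdiv_lt_0_compat; lra. }
  assert (hs : 0 < sin theta) by (apply sin_gt_0; lra).
  assert (hcos : forall x, cos (2 * (PI / 2 - gd_angle theta x)) + cos theta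
            = - (sin theta * sin theta / (cosh (2 * x) + cos theta))).
  { intros x. rewrite <- (cos_double_gd_angle theta x htheta).
    replace (2 * (PI / 2 - gd_angle theta x))
      with (- (2 * gd_angle theta x) + PI) by field.
    rewrite neg_cos, cos_neg. ring. }
  (* For [y] in [[beta, PI / 2]], [2 * y] lies between [PI - theta] and [PI],
     where the cosine is below [- cos theta]: the pole is avoided. *)
  assert (hex : ex_RInt (fun y => y / (cos (2 * y) + cos theta)) beta (PI / 2)).
  { apply (ex_RInt_continuous (V := R_CompleteNormedModule)). intros y hy.
    rewrite Rmin_left, Rmax_right in hy by lra.
    apply (ex_derive_continuous (fun y => y / (cos (2 * y) + cos theta))).
    auto_derive.
    assert (cos (2 * y) < cos (PI - theta)) by (apply cos_decreasing_1; lra).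
    replace (cos (PI - theta)) with (- cos theta) in *
      by (replace (PI - theta) with (- theta + PI) by ring;
          rewrite neg_cos, cos_neg; ring).
    lra. }
  (* [PI / 2 - gd_angle theta x] decreases from [PI / 2] to [beta] as [x] grows
     from 0 to [alpha], so the second integral has to be run backwards. *)
  rewrite <- (opp_RInt_swap _ (PI / 2) beta),
    <- (RInt_opp (V := R_CompleteNormedModule))
    by (apply ex_RInt_swap, hex).
  replace (RInt _ (PI / 2) beta)
    with (RInt (fun y => opp (y / (cos (2 * y) + cos theta)))
            (PI / 2 - gd_angle theta 0) (PI / 2 - gd_angle theta alpha))
    by (rewrite gd_angle_0, Rminus_0_r, <- eb; reflexivity).
  rewrite (RInt_add_RInt_along _ _ (fun x => PI / 2 - gd_angle theta x)
             (fun x => - (sin theta / (cosh (2 * x) + cos theta)))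
             (- / sin theta)).
  - rewrite <- eb. field. lra.
  - intros x _.
    replace (- (sin theta / (cosh (2 * x) + cos theta)))
      with (minus 0 (sin theta / (cosh (2 * x) + cos theta)))
      by (unfold minus, plus, opp; simpl; ring).
    apply (is_derive_minus (fun _ => PI / 2) (gd_angle theta) x 0).
    + apply (is_derive_const (K := R_AbsRing) (V := R_NormedModule)).
    + apply (is_derive_gd_angle theta x htheta).
  - intros x _.
    apply (continuous_opp
             (fun x => sin theta / (cosh (2 * x) + cos theta))).
    apply (continuous_gd_angle_derivative theta x htheta).
  - intros x _.
    apply (continuous_opp (fun y => y / (cos (2 * y) + cos theta))).
    apply (ex_derive_continuous (fun y => y / (cos (2 * y) + cos theta))).
    auto_derive.
    rewrite hcos. apply Ropp_neq_0_compat, Rgt_not_eq.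
    pose proof (cosh_double_add_cos_pos theta x htheta).
    apply Rdiv_lt_0_compat; nra.
  - intros x _. pose proof (cosh_double_add_cos_pos theta x htheta). field. lra.
  - intros x _. rewrite hcos. unfold opp; simpl.
    pose proof (cosh_double_add_cos_pos theta x htheta). field. lra.
Qed.

Theorem proposition12 (theta alpha : R)
    (htheta : 0 < theta < PI) (halpha : 0 < alpha) :
  (forall beta : R,
     0 < beta < theta / 2 ->
     tanh alpha = cot (theta / 2) * tan beta ->
     RInt (fun x : R => x / (cosh (2 * x) + cos theta)) 0 alpha
     + RInt (fun y : R => y / (cos (2 * y) - cos theta)) 0 beta
     = alpha * beta / sin theta)
  /\
  (forall beta : R,
     (PI - theta) / 2 < beta < PI / 2 ->
     tanh alpha * tan beta = cot (theta / 2) ->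
     RInt (fun x : R => x / (cosh (2 * x) + cos theta)) 0 alpha
     + RInt (fun y : R => y / (cos (2 * y) + cos theta)) beta (PI / 2)
     = - (alpha * beta / sin theta)).
Proof.
  split; intros beta hbeta e.
  - now apply RInt_lower_branch.
  - now apply RInt_upper_branch.
Qed.
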